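(* Let $\boldsymbol{S}$ be a random dataset in $\mathcal{X}^n$ and let $\mathcal{A}$ be a (possibly randomized) algorithm with input in $\mathcal{X}^n$ and range $\mathcal{Y}$ such that for some $\beta\ge 0$, $I_\infty^\beta(\boldsymbol{S};\mathcal{A}(\boldsymbol{S}))=k$. Then for any event $\mathcal{O}\subseteq\mathcal{X}^n\times\mathcal{Y}$, $$\Pr[(\boldsymbol{S},\mathcal{A}(\boldsymbol{S}))\in\mathcal{O}]\le 2^k\cdot\Pr[\boldsymbol{S}\times\mathcal{A}(\boldsymbol{S})\in\mathcal{O}]+\beta.$$ In particular, $\Pr[(\boldsymbol{S},\mathcal{A}(\boldsymbol{S}))\in\mathcal{O}]\le 2^k\cdot\max_{y\in\mathcal{Y}}\Pr[(\boldsymbol{S},y)\in\mathcal{O}]+\beta$.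
   Context: All random variables take values in finite domains; $\log$ is the binary logarithm. For jointly distributed random variables $\boldsymbol{X},\boldsymbol{Y}$, $\boldsymbol{X}\times\boldsymbol{Y}$ denotes the random variable obtained by drawing $\boldsymbol{X}$ and $\boldsymbol{Y}$ independently from their (marginal) probability distributions. For random variables $\boldsymbol{U},\boldsymbol{V}$ over the same domain $\mathcal{D}$, the $\delta$-approximate max-divergence is $$D_\infty^\delta(\boldsymbol{U}\|\boldsymbol{V})=\log\max_{\mathcal{O}\subseteq\mathcal{D},\ \Pr[\boldsymbol{U}\in\mathcal{O}]>\delta}\frac{\Pr[\boldsymbol{U}\in\mathcal{O}]-\delta}{\Pr[\boldsymbol{V}\in\mathcal{O}]}.$$ The $\beta$-approximate max-information between $\boldsymbol{X}$ and $\boldsymbol{Y}$ is $I_\infty^\beta(\boldsymbol{X};\boldsymbol{Y})=D_\infty^\beta((\boldsymbol{X},\boldsymbol{Y})\|\boldsymbol{X}\times\boldsymbol{Y})$. *)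

(* Defs.v *)
From mathcomp Require Import all_boot all_order all_algebra.
From mathcomp Require Import boolp reals ereal exp.
Set Implicit Arguments.
Unset Strict Implicit.
Unset Printing Implicit Defensive.
Import Order.TTheory GRing.Theory Num.Theory.
Local Open Scope ring_scope.

(* Random variables with values in a finite type are represented by their law,
   and jointly distributed ones by their joint law on the product type. *)
Record fdist (R : realType) (T : finType) := FDist {
  pmf :> T -> R;
  pmf_ge0 : forall t, 0 <= pmf t;
  pmf_sum1 : \sum_t pmf t = 1 }.

Definition Pr (R : realType) (T : finType) (U : fdist R T) (O : {set T}) : R :=
  \sum_(t in O) U t.

Section Constructions.
Variables (R : realType) (T1 T2 : finType).

Fact map_ge0 (f : T1 -> T2) (U : fdist R T1) t :
  0 <= Pr U [set x | f x == t].
Proof. by apply: sumr_ge0 => x _; exact: pmf_ge0. Qed.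

Fact map_sum1 (f : T1 -> T2) (U : fdist R T1) :
  \sum_t Pr U [set x | f x == t] = 1.
Proof.
rewrite -(pmf_sum1 U) (partition_big f xpredT) //=.
by apply: eq_bigr => t _; apply: eq_bigl => x; rewrite inE.
Qed.

Definition fdmap (f : T1 -> T2) (U : fdist R T1) : fdist R T2 :=
  FDist (map_ge0 f U) (map_sum1 f U).

Fact graph_ge0 (U : fdist R T1) (A : T1 -> fdist R T2) (p : T1 * T2) :
  0 <= U p.1 * A p.1 p.2.
Proof. by apply: mulr_ge0; exact: pmf_ge0. Qed.

Fact graph_sum1 (U : fdist R T1) (A : T1 -> fdist R T2) :
  \sum_(p : T1 * T2) U p.1 * A p.1 p.2 = 1.
Proof.
rewrite -(pair_bigA _ (fun x y => U x * A x y)) /= -(pmf_sum1 U).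
by apply: eq_bigr => x _; rewrite -mulr_sumr pmf_sum1 mulr1.
Qed.

(* The joint law of (U, A(U)) for a randomized algorithm A, where A x is the
   law of the output of A on the fixed input x. *)
Definition with_output (U : fdist R T1) (A : T1 -> fdist R T2) :
    fdist R (T1 * T2)%type :=
  FDist (graph_ge0 U A) (graph_sum1 U A).

End Constructions.

(* X x Y for (X, Y) of joint law W: independent draws from the marginals. *)
Definition indep (R : realType) (T1 T2 : finType)
    (W : fdist R (T1 * T2)%type) : fdist R (T1 * T2)%type :=
  with_output (fdmap fst W) (fun=> fdmap snd W).

Definition log2e (R : realType) (x : \bar R) : \bar R :=
  (lne x / (ln 2)%:E)%E.

Definition exp2e (R : realType) (x : \bar R) : \bar R :=
  match x with
  | r%:E => (2 `^ r)%:E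
  | +oo => +oo
  | -oo => 0
  end%E.

(* Division in \bar R satisfies p / 0 = +oo for p > 0. The maximum over the
   empty family (which occurs exactly when 1 <= delta) is -oo, and so is its
   logarithm. *)
Definition max_divergence (R : realType) (T : finType) (delta : R)
    (U V : fdist R T) : \bar R :=
  log2e (\big[maxe/-oo]_(O : {set T} | (delta < Pr U O)%R)
           ((Pr U O - delta)%:E / (Pr V O)%:E))%E.

Definition max_information (R : realType) (T1 T2 : finType) (beta : R)
    (W : fdist R (T1 * T2)%type) : \bar R :=
  max_divergence beta W (indep W).

(* Main.v *)
Require Import Defs.
From mathcomp Require Import all_boot all_order all_algebra.
From mathcomp Require Import boolp reals ereal exp.
Import Order.TTheory GRing.Theory Num.Theory.
Local Open Scope ring_scope.

(* If Pr[U in O] > delta, then O itself competes in the maximum defining the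
   max-divergence, which gives the bound after multiplying by Pr[V in O]; this
   needs Pr[V in O] > 0, and indeed a joint law is absolutely continuous with
   respect to the product of its marginals. The second bound holds because the
   product probability of O is the average of Pr[(S, y) in O] over the law of
   y. *)

Lemma exp2e_ge0 {R : realType} (x : \bar R) : (0 <= exp2e x)%E.
Proof. by case: x => [r| |] //=; rewrite ?leey// lee_fin powR_ge0. Qed.

(** The endpoints match: [log2e] sends 0 to [-oo], which [exp2e] sends back to 0, and both fix
    [+oo]. Negative values also go to [-oo], so the identity fails for them. *)
Lemma log2eK {R : realType} (x : \bar R) : (0 <= x)%E -> exp2e (log2e x) = x.
Proof.
have ln2_gt0 : 0 < ln 2 :> R by rewrite ln_gt0// ltr1n.
have ln2_neq0 : ln 2 != 0 :> R by rewrite gt_eqF.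
rewrite /log2e inver (negPf ln2_neq0); case: x => [r| |] //=.
- rewrite lee_fin le_eqVlt => /predU1P[<-|r_gt0].
    by rewrite lexx gt0_mulNye// lte_fin invr_gt0.
  rewrite leNgt r_gt0 -EFinM /= /powR pnatr_eq0 /=.
  by rewrite mulfVK// lnK.
- by rewrite gt0_mulye// lte_fin invr_gt0.
Qed.

Lemma Pr_ge0 {R : realType} {T : finType} (U : fdist R T) (O : {set T}) :
  0 <= Pr U O.
Proof. by apply: sumr_ge0 => t _; exact: pmf_ge0. Qed.

Lemma Pr_eq0P {R : realType} {T : finType} (U : fdist R T) (O : {set T}) :
  Pr U O = 0 <-> {in O, forall t, U t = 0}.
Proof.
split=> [/psumr_eq0P U0 t tO|U0]; last by rewrite /Pr big1.
by apply: U0 => // s _; exact: pmf_ge0.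
Qed.

Lemma Pr_le_max_divergence {R : realType} {T : finType} (delta : R)
    (U V : fdist R T) (O : {set T}) :
  0 <= delta -> (Pr V O = 0 -> Pr U O = 0) ->
  ((Pr U O)%:E <= exp2e (max_divergence delta U V) * (Pr V O)%:E + delta%:E)%E.
Proof.
move=> delta_ge0 UV; have [leUd|ltdU] := leP (Pr U O) delta.
  (* Here [O] does not compete in the maximum, but [delta] alone bounds [Pr U O], since the product
     is nonnegative. *)
  rewrite (@le_trans _ _ delta%:E) ?lee_fin// leeDr//.
  by rewrite mule_ge0 ?exp2e_ge0// lee_fin Pr_ge0.
have V_gt0 : 0 < Pr V O.
  rewrite lt_neqAle Pr_ge0 andbT eq_sym; apply/eqP => /UV U0.
  by move: ltdU; rewrite U0 ltNge delta_ge0.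
pose ratio (Q : {set T}) := ((Pr U Q - delta)%:E / (Pr V Q)%:E)%E.
have le_ratio : (ratio O <= \big[maxe/-oo]_(Q | (delta < Pr U Q)%R) ratio Q)%E.
  exact: le_bigmax_cond.
have ratioE : ratio O = ((Pr U O - delta) / Pr V O)%:E.
  by rewrite /ratio inver gt_eqF// -EFinM.
(* Undoing the logarithm requires a nonnegative maximum; dominating [ratio O] ensures this and
   excludes the default [-oo]. *)
rewrite /max_divergence -/ratio log2eK; last first.
  apply: le_trans le_ratio.
  by rewrite ratioE lee_fin divr_ge0 ?Pr_ge0// subr_ge0 ltW.
by rewrite -leeBlDr// -EFinB -lee_pdivrMr// -EFinM -ratioE.
Qed.

Lemma pmf_le_fdmap {R : realType} {T1 T2 : finType} (f : T1 -> T2)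
    (U : fdist R T1) (x : T1) : U x <= fdmap f U (f x).
Proof.
rewrite /= /Pr (bigD1 x) ?inE//= lerDl.
by apply: sumr_ge0 => t _; exact: pmf_ge0.
Qed.

(** At a point where the product vanishes, one of the marginals does, and each marginal dominates
    the joint mass. *)
Lemma Pr_indep_eq0 {R : realType} {T1 T2 : finType}
    (W : fdist R (T1 * T2)%type) (O : {set T1 * T2}) :
  Pr (indep W) O = 0 -> Pr W O = 0.
Proof.
move=> /Pr_eq0P I0; apply/Pr_eq0P => p /I0 /eqP; rewrite mulf_eq0.
by case/orP=> /eqP p0; apply/le_anti; rewrite pmf_ge0 andbT -p0;
  exact: pmf_le_fdmap.
Qed.

Lemma fdmap_fst_with_output {R : realType} {T1 T2 : finType} (U : fdist R T1)
    (A : T1 -> fdist R T2) (x : T1) : fdmap fst (with_output U A) x = U x.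
Proof.
(* The trivial conjunct gives the condition the product form that [pair_big] turns into a double
   sum. *)
rewrite /= /Pr (eq_bigl (fun p => (p.1 == x) && true)); last first.
  by move=> p; rewrite inE andbT.
rewrite -(pair_big (pred1 x) xpredT (fun a b => U a * A a b)) /= big_pred1_eq.
by rewrite -mulr_sumr pmf_sum1 mulr1.
Qed.

Lemma Pr_indep {R : realType} {T1 T2 : finType}
    (W : fdist R (T1 * T2)%type) (O : {set T1 * T2}) :
  Pr (indep W) O =
    \sum_y fdmap snd W y * Pr (fdmap fst W) [set x | (x, y) \in O].
Proof.
under eq_bigr => y _ do rewrite {1}/Pr mulr_sumr.
rewrite (exchange_big_dep xpredT)//= pair_big_dep /=.
by apply: eq_big => [[x y]|[x y] _] /=; rewrite ?inE// mulrC.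
Qed.

Lemma Pr_indep_le_max {R : realType} {T1 T2 : finType} (U : fdist R T1)
    (A : T1 -> fdist R T2) (O : {set T1 * T2}) :
  Pr (indep (with_output U A)) O
    <= \big[Num.max/0]_(y : T2) Pr U [set x | (x, y) \in O].
Proof.
set m := \big[_/_]_y _; set W := with_output U A.
(* Spreading [m] over the total mass 1 of the output law reduces the claim to a comparison for each
   [y]. *)
rewrite Pr_indep -[m]mul1r -(pmf_sum1 (fdmap snd W)) mulr_suml.
apply: ler_sum => y _; apply: ler_wpM2l; first exact: pmf_ge0.
rewrite {1}/Pr (eq_bigr U) => [|x _]; last exact: fdmap_fst_with_output.
exact: (le_bigmax _ (fun y => Pr U [set x | (x, y) \in O])).
Qed.

Theorem theorem13 (R : realType) (X Y : finType) (n : nat)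
    (S : fdist R (n.-tuple X)) (A : n.-tuple X -> fdist R Y)
    (beta : R) (k : \bar R) (hbeta : 0 <= beta)
    (hk : max_information beta (with_output S A) = k)
    (O : {set n.-tuple X * Y}) :
  ((Pr (with_output S A) O)%:E
     <= exp2e k * (Pr (indep (with_output S A)) O)%:E + beta%:E)%E
  /\
  ((Pr (with_output S A) O)%:E
     <= exp2e k *
          (\big[Num.max/0]_(y : Y) Pr S [set s | (s, y) \in O])%:E
        + beta%:E)%E.
Proof.
have le_indep : ((Pr (with_output S A) O)%:E
    <= exp2e k * (Pr (indep (with_output S A)) O)%:E + beta%:E)%E.
  by rewrite -hk; apply: Pr_le_max_divergence => //; exact: Pr_indep_eq0.
split=> //; apply: le_trans le_indep _; rewrite leeD2r//.
by apply: lee_wpmul2l; rewrite ?exp2e_ge0// lee_fin Pr_indep_le_max.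
Qed.
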